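(* Let $S$ be a right LCM monoid with core graph $\Gamma$ and coconnected components $(\Gamma_i)_{i\in I}$ of $\Gamma$. The action $\alpha\colon S_c\curvearrowright S/_\sim$, $\alpha_a([s])=[as]$, determines (by restriction to the vertex set $\mathcal{I}(S)/_\sim$) an action $\beta\colon S_c\curvearrowright\Gamma$ by graph automorphisms. In particular, $\beta_a(\Gamma_i)$ is a coconnected component of $\Gamma$ isomorphic with $\Gamma_i$ for all $i\in I$ and $a\in S_c$.
   Context: A right LCM monoid is a left cancellative monoid $S$ (with unit) in which the intersection $sS\cap tS$ of any two principal right ideals is either empty or again a principal right ideal. For $s,t\in S$ write $s\Cap t$ if $sS\cap tS\neq\emptyset$, and $s\perp t$ otherwise. The core of $S$ is the submonoid $S_c:=\{a\in S\mid a\Cap s\text{ for all }s\in S\}$. Elements $s,t\in S$ are core equivalent, $s\sim t$, if there are $a,b\in S_c$ with $sa=tb$; this is an equivalence relation, and $[s]$ denotes the class of $s$. Left multiplication defines an action $\alpha\colon S_c\curvearrowright S/_\sim$ by bijections, $\alpha_a([s])=[as]$. An element $s\in S$ is noncore irreducible if $s\notin S_c$ and whenever $sa=tr$ for some $a\in S_c$ and $t,r\in S$, then $t\in S_c$ or $r\in S_c$. The set of noncore irreducible elements is denoted $\mathcal{I}(S)$; it is closed under $\sim$. The core graph $\Gamma=\Gamma(S)=(V,E)$ is the undirected simplicial graph with vertex set $V=\mathcal{I}(S)/_\sim$ and an edge between distinct vertices $[s],[t]$ if and only if $s\Cap t$. Its coconnected components $\Gamma_i=(V_i,E_i)$, $i\in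 I$, are the full subgraphs on the vertex sets $V_i$ of the connected components of the complementary graph $(V,V\times V\setminus E)$, so $E_i=(V_i\times V_i)\cap E$. *)

(* Defs.v *)
From HB Require Import structures.
From Stdlib Require Import Relation_Operators.
From mathcomp Require Import all_boot.
From mathcomp Require Import boolp classical_sets.

Set Implicit Arguments.
Unset Strict Implicit.
Unset Printing Implicit Defensive.

Local Open Scope classical_set_scope.
Local Open Scope group_scope.
Local Open Scope quotient_scope.

Definition right_ideal (S : monoidType) (s : S) : set S := range (mul s).

HB.mixin Record Monoid_isRightLCM S of Monoid S := {
  mulg_cancell : forall s : S, injective (mul s);
  right_ideal_capP : forall s t : S,
    right_ideal s `&` right_ideal t = set0 \/
    exists r : S, right_ideal s `&` right_ideal t = right_ideal r
}.

#[short(type="rightLCMMonoidType")]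
HB.structure Definition RightLCMMonoid := {S of Monoid_isRightLCM S & Monoid S}.

Definition meets (S : monoidType) (s t : S) : Prop :=
  right_ideal s `&` right_ideal t !=set0.

Lemma meetsP (S : monoidType) (s t : S) :
  meets s t <-> exists x y, s * x = t * y.
Proof.
split=> [[_ [[x _ <-] [y _ eyx]]]|[x [y exy]]]; first by exists x, y.
by exists (s * x); split; [exists x | exists y].
Qed.

Definition core (S : monoidType) : {pred S} :=
  fun a => `[< forall s : S, meets a s >].
Arguments core : clear implicits.

Lemma coreP (S : monoidType) (a : S) :
  reflect (forall s, meets a s) (a \in core S).
Proof. exact: asboolP. Qed.

Lemma core1 (S : monoidType) : 1 \in core S.
Proof. by apply/coreP=> s; apply/meetsP; exists s, 1; rewrite mul1g mulg1. Qed.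

Lemma coreM (S : monoidType) : mulg_closed (core S).
Proof.
move=> a b /coreP ca /coreP cb; apply/coreP=> s; apply/meetsP.
have /meetsP[x [y axsy]] := ca s; have /meetsP[p [q bpxq]] := cb x.
by exists p, (y * q); rewrite -mulgA bpxq mulgA axsy mulgA.
Qed.

HB.instance Definition _ (S : monoidType) :=
  isMulClosed.Build S (core S) (@coreM S).
HB.instance Definition _ (S : monoidType) :=
  isMul1Closed.Build S (core S) (@core1 S).

Record core_monoid (S : monoidType) :=
  CoreMonoid {core_val : S; _ : core_val \in core S}.
Arguments core_monoid : clear implicits.

HB.instance Definition _ (S : monoidType) := [isSub for @core_val S].
HB.instance Definition _ (S : monoidType) := [Choice of core_monoid S by <:].
HB.instance Definition _ (S : monoidType) :=
  SubChoice_isSubMonoid.Build S (core S) (core_monoid S)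
    (conj (@core1 S) (@coreM S)).

Definition core_equiv (S : monoidType) : rel S := fun s t =>
  `[< exists a b : S, [/\ a \in core S, b \in core S & s * a = t * b] >].

Section CoreQuotient.
Variable S : rightLCMMonoidType.
Implicit Types (a b s t x y : S).

Lemma core_common a b : a \in core S -> b \in core S ->
  exists x y, [/\ x \in core S, y \in core S & a * x = b * y].
Proof.
move=> ca cb; have /coreP/(_ b)[z zab] := ca.
have [e0|[r er]] := right_ideal_capP a b; first by move: zab; rewrite e0.
have : (right_ideal a `&` right_ideal b) r.
  by rewrite er; exists 1; rewrite // mulg1.
move=> [[x _ axr] [y _ byr]]; exists x, y; split; last by rewrite axr byr.
- apply/coreP=> s; have /coreP/(_ (a * s))/meetsP[q [p bqasp]] := cb.
  have : right_ideal r (a * s * p).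
    by rewrite -er; split; [exists (s * p); rewrite // mulgA | exists q].
  move=> [w _]; rewrite -axr -!mulgA => /mulg_cancell xwsp.
  by apply/meetsP; exists w, p.
- apply/coreP=> s; have /coreP/(_ (b * s))/meetsP[q [p aqbsp]] := ca.
  have : right_ideal r (b * s * p).
    by rewrite -er; split; [exists q | exists (s * p); rewrite // mulgA].
  move=> [w _]; rewrite -byr -!mulgA => /mulg_cancell ywsp.
  by apply/meetsP; exists w, p.
Qed.

Lemma core_equiv_refl : reflexive (@core_equiv S).
Proof. by move=> s; apply/asboolP; exists 1, 1; split=> //; exact: core1. Qed.

Lemma core_equiv_sym : symmetric (@core_equiv S).
Proof.
by move=> s t; apply/asboolP/asboolP=> -[a [b [ca cb e]]]; exists b, a.
Qed.

Lemma core_equiv_trans : transitive (@core_equiv S).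
Proof.
move=> t s r /asboolP[a [b [ca cb satb]]] /asboolP[c [d [cc cd tcrd]]].
have [x [y [cx cy bxcy]]] := core_common cb cc.
apply/asboolP; exists (a * x), (d * y); split; [exact: coreM..|].
by rewrite mulgA satb -mulgA bxcy mulgA tcrd mulgA.
Qed.

Canonical core_equiv_equiv :=
  EquivRel (@core_equiv S) core_equiv_refl core_equiv_sym core_equiv_trans.

Definition core_quot := {eq_quot core_equiv_equiv}.
HB.instance Definition _ := EqQuotient.on core_quot.
HB.instance Definition _ := Choice.on core_quot.

Definition core_class s : core_quot := \pi_core_quot s.

Lemma core_classP s t :
  core_class s = core_class t <->
  exists a b, [/\ a \in core S, b \in core S & s * a = t * b].
Proof.
by split=> [/eqquotP/asboolP|e]; last by apply/eqquotP/asboolP.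
Qed.

Definition core_act (a : core_monoid S) : core_quot -> core_quot :=
  lift_op1 core_quot (mul (val a)).

Lemma core_actE (a : core_monoid S) s :
  core_act a (core_class s) = core_class (val a * s).
Proof.
rewrite /core_act; unlock; apply/core_classP.
have /core_classP[b [c [cb cc e]]] := reprK (core_class s).
by exists b, c; split=> //; rewrite -!mulgA e.
Qed.

End CoreQuotient.

Arguments core_quot : clear implicits.

Record graph := Graph {
  vertex :> Type;
  adj : vertex -> vertex -> Prop;
  adj_sym : forall u v, adj u v -> adj v u;
  adj_irrefl : forall u, ~ adj u u
}.

Definition graph_isomorphic (G H : graph) : Prop :=
  exists2 f : G -> H, bijective f & forall u v, adj (f u) (f v) <-> adj u v.

Record graph_aut (G : graph) := GraphAut {
  aut_fun :> G -> G;
  aut_bij : bijective aut_fun;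
  aut_adj : forall u v, adj (aut_fun u) (aut_fun v) <-> adj u v
}.

Record subgraph (G : graph) := Subgraph {
  sverts : set G;
  sedges : G -> G -> Prop;
  sedges_verts : forall u v, sedges u v -> sverts u /\ sverts v;
  sedges_adj : forall u v, sedges u v -> adj u v;
  sedges_sym : forall u v, sedges u v -> sedges v u
}.

Definition subgraph_graph (G : graph) (H : subgraph G) : graph :=
  @Graph (sverts H) (fun u v => sedges H (val u) (val v))
    (fun u v => @sedges_sym G H (val u) (val v))
    (fun u e => adj_irrefl (sedges_adj e)).
Coercion subgraph_graph : subgraph >-> graph.

Definition full_subgraph (G : graph) (A : set G) : subgraph G.
Proof.
exists A (fun u v => [/\ A u, A v & adj u v]).
- by move=> u v [].
- by move=> u v [].
- by move=> u v [Au Av /adj_sym].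
Defined.

Definition subgraph_image (G : graph) (f : graph_aut G) (H : subgraph G) :
  subgraph G.
Proof.
exists (f @` sverts H)
  (fun u v => exists u' v', [/\ sedges H u' v', f u' = u & f v' = v]).
- by move=> _ _ [u [v [/sedges_verts[Hu Hv] <- <-]]]; split;
    [exists u | exists v].
- by move=> _ _ [u [v [/sedges_adj uv <- <-]]]; apply/aut_adj.
- by move=> _ _ [u [v [/sedges_sym vu <- <-]]]; exists v, u.
Defined.

(* Vertices in one connected component of the complementary graph, whose edge
   relation V x V \ E has a loop at every vertex. *)
Definition coconnected (G : graph) : G -> G -> Prop :=
  clos_refl_trans G (fun u v => ~ adj u v).

Definition coconnected_component (G : graph) (H : subgraph G) : Prop :=
  exists v : G, H = full_subgraph [set w | coconnected v w].

Definition monoid_action (M : monoidType) (X : Type) (act : M -> X -> X) :=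
  (forall x, act 1 x = x) /\
  (forall a b x, act (a * b) x = act a (act b x)).

Definition noncore_irreducible (S : monoidType) : set S := [set s |
  s \notin core S /\
  forall a t r : S, a \in core S -> s * a = t * r ->
    t \in core S \/ r \in core S].
Arguments noncore_irreducible : clear implicits.

Section CoreGraph.
Variable S : rightLCMMonoidType.

Definition core_vertices : set (core_quot S) :=
  [set core_class s | s in noncore_irreducible S].

Definition core_adj (u v : core_vertices) : Prop :=
  u <> v /\
  exists s t : S, [/\ core_class s = val u, core_class t = val v & meets s t].

Lemma core_adj_sym u v : core_adj u v -> core_adj v u.
Proof.
move=> [nuv [s [t [su tv /meetsP[x [y e]]]]]]; split; first exact: nesym.
by exists t, s; split=> //; apply/meetsP; exists y, x.
Qed.

Lemma core_adj_irrefl u : ~ core_adj u u.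
Proof. by case. Qed.

Definition core_graph : graph := Graph core_adj_sym core_adj_irrefl.

(* Adjacency does not depend on the choice of representatives. *)
Lemma core_adjE (u v : core_vertices) (s t : S) :
  core_class s = val u -> core_class t = val v -> core_adj u v <-> u <> v /\ meets s t.
Proof.
move=> su tv; split=> [[nuv [s' [t' [s'u t'v /meetsP[x [y e]]]]]]|[nuv st]];
  last by split=> //; exists s, t.
split=> //; apply/meetsP.
have /core_classP[a [b [ca cb sas'b]]] := etrans su (esym s'u).
have /core_classP[c [d [cc cd tct'd]]] := etrans tv (esym t'v).
have /coreP/(_ x)/meetsP[p [q bpxq]] := cb.
have /coreP/(_ (y * q))/meetsP[m [n dmyqn]] := cd.
exists (a * p * n), (c * m).
rewrite !mulgA sas'b tct'd -[s' * b * p]mulgA bpxq mulgA e.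
by rewrite -[RHS]mulgA dmyqn !mulgA.
Qed.

End CoreGraph.

Arguments core_vertices : clear implicits.
Arguments core_graph : clear implicits.

(* Main.v *)
(* Cancelling on the left, [as] meets [at] iff [s] meets [t], so left
   multiplication by a core element [a] is injective on classes and preserves
   adjacency.  If [aS] and [tS] intersect in [kS] with [k = ap = tq], then [q] is
   again core because [a] is.  Any factorisation of a multiple of [as] through
   [t] therefore descends to one of a multiple of [s] through [p], so [as] is
   irreducible when [s] is; and [t ~ tq = ap], so every class is reached by [a].
   Automorphisms of a graph also preserve its complement, hence permute the
   coconnected components. *)
Require Import Defs.
From HB Require Import structures.
From Stdlib Require Import Relation_Operators.
From mathcomp Require Import all_boot.
From mathcomp Require Import boolp classical_sets.

Set Implicit Arguments.
Unset Strict Implicit.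
Unset Printing Implicit Defensive.

Section Core.
Local Open Scope group_scope.
Variable S : rightLCMMonoidType.
Implicit Types a b s t p q : S.

Lemma core_divl s t : s * t \in core S -> s \in core S.
Proof.
move=> /coreP st; apply/coreP=> x; have /meetsP[y [z e]] := st x.
by apply/meetsP; exists (t * y), z; rewrite mulgA.
Qed.

Lemma meets_mul2l a s t : Defs.meets (a * s) (a * t) <-> Defs.meets s t.
Proof.
split=> /meetsP[x [y e]]; apply/meetsP; exists x, y; last by rewrite -!mulgA e.
by apply: (@mulg_cancell S a); rewrite !mulgA.
Qed.

Lemma core_divr a s : a * s \in core S -> s \in core S.
Proof.
by move=> /coreP as_core; apply/coreP=> t; exact/(meets_mul2l a).
Qed.

(** As [a] is core, [aS] and [tS] intersect, so the right LCM property gives the intersection a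
    generator [k = a * p = t * q]. Cancelling [a] and [t] yields the common cofactor [w]. *)
Lemma core_lcm a t : a \in core S -> exists p q, [/\ q \in core S, a * p = t * q
  & forall x y, a * x = t * y -> exists w, x = p * w /\ y = q * w].
Proof.
move=> /coreP ca.
have [e0|[k ek]] := right_ideal_capP a t.
  by have [z] := ca t; rewrite e0.
have [[p _ apk] [q _ tqk]] : (right_ideal a `&` right_ideal t)%classic k.
  by rewrite ek; exists 1; rewrite // mulg1.
have lcmP x y : a * x = t * y -> exists w, x = p * w /\ y = q * w.
  move=> e; have : right_ideal k (a * x).
    by rewrite -ek; split; [exists x | exists y].
  move=> [w _ kw]; exists w.
  split; first by apply: (@mulg_cancell S a); rewrite mulgA apk kw.
  by apply: (@mulg_cancell S t); rewrite mulgA tqk kw e.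
exists p, q; split=> //; last by rewrite apk tqk.
(* A common multiple of [a] and [t * s] is also one of [a] and [t], so its cofactor [s * y] is a
   multiple of [q]. *)
apply/coreP=> s; have /meetsP[x [y]] := ca (t * s).
rewrite -mulgA => /lcmP[w [_ syw]].
by apply/meetsP; exists w, y.
Qed.

(** The case of invariance under core equivalence that surjectivity of the action needs. *)
Lemma noncore_irreducible_mulr s b :
  b \in core S -> noncore_irreducible S s -> noncore_irreducible S (s * b).
Proof.
move=> cb [ns irr]; split; first by apply: contra ns; exact: core_divl.
move=> c t r cc; rewrite -mulgA; apply: irr; exact: coreM.
Qed.

Lemma noncore_irreducible_mull a s : a \in core S ->
  noncore_irreducible S (a * s) <-> noncore_irreducible S s.
Proof.
move=> ca; split=> -[ns irr].
  split; first by apply: contra ns; exact: coreM.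
  move=> b t r cb e.
  (* Multiply the factorisation by [a] on the left, then strip [a] from a core [a * t]. *)
  have [|/core_divr|] := irr b (a * t) r cb; last by right.
    by rewrite -!mulgA e.
  by left.
split; first by apply: contra ns; exact: core_divr.
move=> b t r cb; rewrite -mulgA => e.
have [p [q [cq apq lcmP]]] := core_lcm t ca.
have [w [sbw ->]] := lcmP _ _ e.
have [cp|cw] := irr _ _ _ cb sbw; last by right; exact: coreM.
(* If [p] is core, so is [a * p = t * q], and hence its left factor [t]. *)
by left; apply: (@core_divl _ q); rewrite -apq; exact: coreM.
Qed.

Lemma core_act1 (u : core_quot S) : core_act 1 u = u.
Proof. by rewrite -(reprK u) core_actE mul1g. Qed.

Lemma core_actM (a b : core_monoid S) (u : core_quot S) :
  core_act (a * b) u = core_act a (core_act b u).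
Proof. by rewrite -(reprK u) !core_actE mulgA. Qed.

Lemma core_act_inj (a : core_monoid S) : injective (@core_act S a).
Proof.
move=> u v; rewrite -(reprK u) -(reprK v) !core_actE.
move=> /core_classP[b [c [cb cc e]]]; apply/core_classP; exists b, c.
by split=> //; apply: (@mulg_cancell S (val a)); rewrite !mulgA.
Qed.

Lemma core_act_vertices (a : core_monoid S) (u : core_quot S) :
  core_vertices S u -> core_vertices S (core_act a u).
Proof.
move=> [s irr <-]; rewrite core_actE; exists (val a * s) => //.
by apply/noncore_irreducible_mull; [exact: valP|].
Qed.

Lemma core_act_vertices_surj (a : core_monoid S) (v : core_quot S) :
  core_vertices S v -> exists2 u, core_vertices S u & core_act a u = v.
Proof.
move=> [s irr <-]; have [p [q [cq apq _]]] := core_lcm s (valP a).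
exists (core_class p).
  exists p => //; apply/(noncore_irreducible_mull _ (valP a)).
  by rewrite apq; exact: noncore_irreducible_mulr.
rewrite core_actE; apply/core_classP; exists 1, q.
by split=> //; rewrite ?core1 // mulg1.
Qed.

Definition core_graph_map (a : core_monoid S) (v : core_graph S) :
    core_graph S :=
  SigSub (mem_set (core_act_vertices a (set_valP v))).

Lemma core_graph_map_inj (a : core_monoid S) : injective (core_graph_map a).
Proof. by move=> u v /(congr1 val)/core_act_inj/val_inj. Qed.

Lemma core_graph_map_bij (a : core_monoid S) : bijective (core_graph_map a).
Proof.
have surj v : exists u, core_graph_map a u = v.
  have [u uV e] := core_act_vertices_surj a (set_valP v).
  by exists (SigSub (mem_set uV)); apply: val_inj.
(* Chosen preimages form a right inverse, which injectivity makes two-sided. *)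
have [g gK] := choice surj.
by exists g => // u; apply: (@core_graph_map_inj a).
Qed.

Lemma core_graph_map_adj (a : core_monoid S) (u v : core_graph S) :
  adj (core_graph_map a u) (core_graph_map a v) <-> adj u v.
Proof.
have [s _ su] := set_valP u; have [t _ tv] := set_valP v.
(* Adjacency may be tested on any representatives; [a * s] and [a * t] allow cancelling [a]. *)
have asu : core_class (val a * s) = val (core_graph_map a u).
  by rewrite /= -core_actE su.
have atv : core_class (val a * t) = val (core_graph_map a v).
  by rewrite /= -core_actE tv.
rewrite /= (core_adjE asu atv) (core_adjE su tv) meets_mul2l.
split=> -[nuv st]; split=> // e; apply: nuv; first by rewrite e.
exact: core_graph_map_inj e.
Qed.

Definition core_graph_aut (a : core_monoid S) : graph_aut (core_graph S) :=
  GraphAut (core_graph_map_bij a) (core_graph_map_adj a).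

End Core.

Section GraphAutomorphism.
Local Open Scope classical_set_scope.
Variables (G : graph) (f : graph_aut G).

(** The remaining fields are proofs, equal by proof irrelevance. Components are specified by
    equality of subgraphs, so this is needed to identify their images. *)
Lemma subgraph_ext (H K : subgraph G) :
  sverts H = sverts K -> sedges H = sedges K -> H = K.
Proof.
case: H K => [V E p q r] [V' E' p' q' r'] /= eV eE; subst V' E'.
by congr Subgraph; exact: Prop_irrelevance.
Qed.

Lemma subgraph_image_full (A : set G) :
  subgraph_image f (full_subgraph A) = full_subgraph (f @` A).
Proof.
apply: subgraph_ext => //=; apply/funext=> u; apply/funext=> v; apply/propext.
split.
  move=> [u' [v' [[Au' Av' uv] <- <-]]].
  by split; [exists u' | exists v' | exact/aut_adj].
by move=> [[u' Au' <-] [v' Av' <-] /aut_adj uv]; exists u', v'.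
Qed.

Lemma coconnected_aut (u v : G) : coconnected (f u) (f v) <-> coconnected u v.
Proof.
have [g fK gK] := aut_bij f.
split=> [|uv].
  (* Writing the target endpoints as [g (f u)] and [g (f v)] lets the induction carry a whole path
     back along [g]. *)
  rewrite -{2}(fK u) -{2}(fK v); elim=> [x y nxy|x|x y z _ xy _ yz].
  - by apply: rt_step; rewrite -(aut_adj f) !gK.
  - exact: rt_refl.
  - exact: rt_trans xy yz.
elim: uv => [x y nxy|x|x y z _ xy _ yz].
- by apply: rt_step; rewrite aut_adj.
- exact: rt_refl.
- exact: rt_trans xy yz.
Qed.

Lemma coconnected_component_image (C : subgraph G) :
  coconnected_component C -> coconnected_component (subgraph_image f C).
Proof.
move=> [v ->]; exists (f v); rewrite subgraph_image_full; congr full_subgraph.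
have [g _ gK] := aut_bij f.
apply/seteqP; split=> [_ [w vw <-]|w /=]; first exact/coconnected_aut.
by rewrite -{1}(gK w) => /coconnected_aut vgw; exists (g w).
Qed.

(** The isomorphism is the inverse [g] of [f], restricted to the image of [H]. *)
Lemma subgraph_image_isomorphic (H : subgraph G) :
  graph_isomorphic (subgraph_image f H) H.
Proof.
have [g fK gK] := aut_bij f.
have gH (u : subgraph_image f H) : sverts H (g (val u)).
  by have [w Hw <-] := set_valP u; rewrite fK.
have fH (u : H) : (f @` sverts H) (f (val u)).
  by exists (val u) => //; exact: set_valP.
exists (fun u => SigSub (mem_set (gH u)) : H).
  exists (fun u => SigSub (mem_set (fH u)) : subgraph_image f H) => u.
    by apply: val_inj; rewrite /= gK.
  by apply: val_inj; rewrite /= fK.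
move=> u v /=; split=> [uv|[u' [v' [uv <- <-]]]]; last by rewrite !fK.
by exists (g (val u)), (g (val v)); rewrite !gK.
Qed.

End GraphAutomorphism.

Theorem proposition4p7 (S : rightLCMMonoidType) :
  exists beta : core_monoid S -> graph_aut (core_graph S),
    [/\ monoid_action (fun a => aut_fun (beta a)),
        (forall (a : core_monoid S) (v : core_graph S),
           val (beta a v : core_vertices S) = core_act a (val v))
      & (forall (a : core_monoid S) (C : subgraph (core_graph S)),
           coconnected_component C ->
           coconnected_component (subgraph_image (beta a) C) /\
           graph_isomorphic (subgraph_image (beta a) C) C)].
Proof.
exists (@core_graph_aut S); split=> //.
- split=> [v|a b v]; apply: val_inj; first exact: core_act1.
  exact: core_actM.
- move=> a C compC; split; first exact: coconnected_component_image.
  exact: subgraph_image_isomorphic.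
Qed.
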